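(* Let $q\in\kappa$ be generic for $\Gamma$, and let $\Psi=(V_i,A^i_j)$ be a representation of the quiver $\mathbb{Q}_I$, i.e. finite dimensional spaces $V_i$ $(i\in I)$ and linear maps $A^i_j:V_i\to V_j$ $(i\neq j)$. Let $V_{i,j}=\ker(A^j_iA^i_j-\mathrm{id})\subset V_i$, and suppose $V_{i,j}=0$ for all $i\neq j\in I$. Then $\Psi$ is an $H$-representation of type $(\Gamma;q)$ if and only if $(A^i_j,A^j_i)$ is a specialized $(m_{i,j};q)$-couple between $V_i$ and $V_j$ for all $i\ne j\in I$.
   Context: $I$ is a finite set, $\Gamma=[m_{i,j}]_{i,j\in I}$ a Coxeter matrix ($m_{i,i}=1$, $m_{i,j}=m_{j,i}\ge2$ finite integers for $i\ne j$), $\kappa$ a field. The numbers $4\cos^2(a\pi/m)$, $m=m_{i,j}$, are regarded as elements of $\kappa$ (i.e. $2+\zeta^a+\zeta^{-a}$ with $\zeta$ a primitive $m$-th root of unity). $q\in\kappa\setminus\{0\}$ is generic if for all $i\ne j$ the dihedral Hecke algebra $H_q(I_{m_{i,j}})$ (generators $\sigma_1,\sigma_2$; $\sigma_1\sigma_2\cdots=\sigma_2\sigma_1\cdots$ with $m_{i,j}$ factors; $(\sigma_k-q)(\sigma_k+1)=0$) is semisimple. Put $\lambda_{m;q}(a)=4\cos^2(a\pi/m)\frac{1}{q+q^{-1}+2}$. For linear $f:V\to W$, $g:W\to V$, $(f,g)$ is an $(m;q)$-couple between $V$ and $W$ if $gf$, $fg$ are diagonalizable with eigenvalues in $\{1\}\cup\{\lambda_{m;q}(a):1\le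 a\le[\frac{m-1}{2}]\}$ when $m$ is odd; for $m$ even the eigenvalue $0$ is also allowed, and then it is required that $gf(x)=0\Rightarrow f(x)=0$ and $fg(y)=0\Rightarrow g(y)=0$. The couple is specialized if moreover $1$ is omitted from the allowed list: all eigenvalues of $gf$ and $fg$ lie in $\{\lambda_{m;q}(a):1\le a\le[\frac{m-1}{2}]\}$ ($m$ odd), respectively $\{0\}\cup\{\lambda_{m;q}(a):1\le a\le[\frac{m-1}{2}]\}$ ($m$ even). $\mathbb{Q}_I$ is the quiver with vertex set $I$ and exactly one arrow $J^i_j$ from $i$ to $j$ for each ordered pair $i\ne j$. $\Psi$ is an $H$-representation of type $(\Gamma;q)$ if: (a) $(A^i_j,A^j_i)$ is an $(m_{i,j};q)$-couple between $V_i$ and $V_j$ for all $i\ne j$; (b) $A^i_k(x)=A^j_kA^i_j(x)$ for distinct $i,j,k$ and $x\in V_{i,j}$; (c) $\mathrm{Im}(A^k_j-A^i_jA^k_i)\subset\mathrm{Im}(\mathrm{id}_{V_j}-A^i_jA^j_i)$ for distinct $i,j,k$. *)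

(* Defs.v *)
From HB Require Import structures.
From mathcomp Require Import all_boot all_order all_algebra.
From mathcomp Require Import generic_quotient ring_quotient.
From mathcomp Require Import boolp.
From mathcomp Require Import monalg.

Set Implicit Arguments.
Unset Strict Implicit.
Unset Printing Implicit Defensive.

Import GRing.Theory.

Local Open Scope ring_scope.
Local Open Scope quotient_scope.

(* The library only quotients commutative rings by proper ideals; algebras    *)
(* given by generators and relations need the quotient of an arbitrary ring   *)
(* by the two-sided ideal generated by a set of relators.                     *)
Section RingPresentation.
Variables (R : nzRingType) (S : R -> Prop).

Definition two_sided_ideal (J : R -> Prop) : Prop :=
  [/\ J 0, forall x y, J x -> J y -> J (x - y)
    & forall a b x, J x -> J (a * x * b)].

Definition in_ideal_gen (x : R) : Prop :=
  forall J, two_sided_ideal J -> (forall s, S s -> J s) -> J x.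

Definition ideal_gen : {pred R} := fun x => `[< in_ideal_gen x >].

Lemma ideal_genP x : reflect (in_ideal_gen x) (x \in ideal_gen).
Proof. exact: asboolP. Qed.

Lemma ideal_gen_zmod_closed : zmod_closed ideal_gen.
Proof.
split=> [|x y /ideal_genP Jx /ideal_genP Jy]; apply/ideal_genP => J idJ sJ.
  by case: (idJ).
by case: (idJ) => _ JB _; apply: JB; [apply: Jx | apply: Jy].
Qed.

HB.instance Definition _ :=
  GRing.isZmodClosed.Build R ideal_gen ideal_gen_zmod_closed.

Lemma ideal_genM a b x : x \in ideal_gen -> a * x * b \in ideal_gen.
Proof.
move=> /ideal_genP Jx; apply/ideal_genP => J idJ sJ.
by case: (idJ) => _ _ JM; apply: JM; apply: Jx.
Qed.

Definition presented_ring : Type := Quotient.quot (ideal_gen : zmodClosed R).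

HB.instance Definition _ := GRing.Zmodule.on presented_ring.
HB.instance Definition _ : EqQuotient R (Quotient.equiv ideal_gen) presented_ring :=
  EqQuotient.on presented_ring.

Definition presented_one : presented_ring := \pi_presented_ring 1.
Definition presented_mul (x y : presented_ring) : presented_ring :=
  \pi_presented_ring (repr x * repr y).

Lemma presented_eqP (x y : R) :
  reflect (\pi_presented_ring x = \pi_presented_ring y) (x - y \in ideal_gen).
Proof. by rewrite Quotient.idealrBE; apply: eqP. Qed.

Lemma presented_addE (x y : R) :
  \pi_presented_ring (x + y) = \pi_presented_ring x + \pi_presented_ring y.
Proof. exact: (Quotient.pi_add ideal_gen). Qed.

Lemma presented_mulE (x y : R) :
  \pi_presented_ring (x * y)
  = presented_mul (\pi_presented_ring x) (\pi_presented_ring y).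
Proof.
apply/presented_eqP.
set x' := repr (\pi_presented_ring x); set y' := repr (\pi_presented_ring y).
have xx' : x - x' \in ideal_gen by apply/presented_eqP; rewrite reprK.
have yy' : y - y' \in ideal_gen by apply/presented_eqP; rewrite reprK.
have -> : x * y - x' * y' = 1 * (x - x') * y + x' * (y - y') * 1.
  by rewrite mul1r mulr1 mulrBl mulrBr addrA subrK.
by rewrite rpredD ?ideal_genM.
Qed.

Lemma presented_surj (x : presented_ring) :
  exists r : R, x = \pi_presented_ring r.
Proof. by exists (repr x); rewrite reprK. Qed.

Lemma presented_mulA : associative presented_mul.
Proof.
move=> x y z; have [[a ->] [b ->] [c ->]] :=
  And3 (presented_surj x) (presented_surj y) (presented_surj z).
by rewrite -!presented_mulE mulrA.
Qed.

Lemma presented_mul1r : left_id presented_one presented_mul.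
Proof.
by move=> x; have [a ->] := presented_surj x; rewrite -presented_mulE mul1r.
Qed.

Lemma presented_mulr1 : right_id presented_one presented_mul.
Proof.
by move=> x; have [a ->] := presented_surj x; rewrite -presented_mulE mulr1.
Qed.

Lemma presented_mulDl : left_distributive presented_mul +%R.
Proof.
move=> x y z; have [[a ->] [b ->] [c ->]] :=
  And3 (presented_surj x) (presented_surj y) (presented_surj z).
by rewrite -presented_addE -!presented_mulE -presented_addE mulrDl.
Qed.

Lemma presented_mulDr : right_distributive presented_mul +%R.
Proof.
move=> x y z; have [[a ->] [b ->] [c ->]] :=
  And3 (presented_surj x) (presented_surj y) (presented_surj z).
by rewrite -presented_addE -!presented_mulE -presented_addE mulrDr.
Qed.

HB.instance Definition _ := GRing.Zmodule_isPzRing.Build presented_ring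
  presented_mulA presented_mul1r presented_mulr1
  presented_mulDl presented_mulDr.

End RingPresentation.

Definition left_ideal (R : pzRingType) (J : R -> Prop) : Prop :=
  [/\ J 0, forall x y, J x -> J y -> J (x + y) & forall a x, J x -> J (a * x)].

(* The left regular module is completely reducible.  For an algebra over a    *)
(* field, left ideals are automatically linear subspaces.                     *)
Definition semisimple (R : pzRingType) : Prop :=
  forall J : R -> Prop, left_ideal J ->
  exists J' : R -> Prop,
    [/\ left_ideal J', forall x, J x -> J' x -> x = 0
      & forall x, exists y z, [/\ J y, J' z & x = y + z]].

(* x * y * x * ... with n factors *)
Fixpoint alt_prod (R : pzRingType) (x y : R) (n : nat) : R :=
  if n is n'.+1 then x * alt_prod y x n' else 1.

Section DihedralHecke.
Variables (K : fieldType) (q : K) (m : nat).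

(* the free associative K-algebra on two generators, indexed by bool *)
Definition free_alg2 := {malg K[{fmonom bool}]}.
Definition sigma (k : bool) : free_alg2 := << fmu k >>.

Inductive hecke_relator : free_alg2 -> Prop :=
| HeckeBraid : hecke_relator
    (alt_prod (sigma false) (sigma true) m
     - alt_prod (sigma true) (sigma false) m)
| HeckeQuadratic (k : bool) : hecke_relator
    ((sigma k - q%:A) * (sigma k + 1)).

Definition dihedral_hecke : pzRingType := presented_ring hecke_relator.

End DihedralHecke.

Section Couples.
Variables (K : fieldType).

Section Diagonalizable.
Variables (V : vectType K).

Definition diagonalizable_end (f : 'End(V)) : Prop :=
  exists2 X : seq V, basis_of fullv X
    & forall x, x \in X -> exists a : K, f x = a *: x.

Definition diagonalizable_with (P : K -> Prop) (f : 'End(V)) : Prop :=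
  diagonalizable_end f /\ forall a : K, passmx.leigenvalue f a -> P a.

End Diagonalizable.

(* c a stands for 4cos^2(a pi / m) = 2 + zeta^a + zeta^-a.  These numbers     *)
(* have to lie in K, but zeta itself may live in an extension L of K.         *)
Definition is_four_cos2 (m : nat) (c : nat -> K) : Prop :=
  exists (L : fieldType) (iota : {rmorphism K -> L}) (zeta : L),
    m.-primitive_root zeta
    /\ forall a : nat, iota (c a) = 2%:R + zeta ^+ a + zeta ^- a.

Section Couple.
Variables (c : nat -> K) (m : nat) (q : K).

Definition hecke_lambda (a : nat) : K := c a * (q + q^-1 + 2%:R)^-1.

Definition specialized_eigenvalue (x : K) : Prop :=
  (~~ odd m /\ x = 0)
  \/ exists2 a : nat, (1 <= a <= (m.-1)./2)%N & x = hecke_lambda a.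

Definition couple_eigenvalue (x : K) : Prop :=
  x = 1 \/ specialized_eigenvalue x.

Variables (V W : vectType K) (f : 'Hom(V, W)) (g : 'Hom(W, V)).

Definition even_condition : Prop :=
  ~~ odd m ->
  (forall x : V, g (f x) = 0 -> f x = 0)
  /\ (forall y : W, f (g y) = 0 -> g y = 0).

Definition couple : Prop :=
  [/\ diagonalizable_with couple_eigenvalue (g \o f)%VF,
      diagonalizable_with couple_eigenvalue (f \o g)%VF
    & even_condition].

Definition specialized_couple : Prop :=
  [/\ diagonalizable_with specialized_eigenvalue (g \o f)%VF,
      diagonalizable_with specialized_eigenvalue (f \o g)%VF
    & even_condition].

End Couple.
End Couples.

Section Coxeter.
Variables (I : finType) (K : fieldType).

Definition coxeter_matrix (Gamma : I -> I -> nat) : Prop :=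
  [/\ forall i, Gamma i i = 1%N,
      forall i j, Gamma i j = Gamma j i
    & forall i j, i != j -> (2 <= Gamma i j)%N].

(* No lambda occurs for m = 2, so no root of unity is required there: the     *)
(* case of m = 2 in characteristic 2 is not excluded.                         *)
Definition four_cos2_for (Gamma : I -> I -> nat) (c : nat -> nat -> K) : Prop :=
  forall i j, i != j -> (2 < Gamma i j)%N ->
  is_four_cos2 (Gamma i j) (c (Gamma i j)).

Definition generic (Gamma : I -> I -> nat) (q : K) : Prop :=
  q != 0 /\ forall i j, i != j -> semisimple (dihedral_hecke q (Gamma i j)).

(* arrow ij, with ij : i != j, is the map A^i_j attached to the arrow J^i_j *)
Record quiver_rep := QuiverRep {
  space :> I -> vectType K;
  arrow : forall i j : I, i != j -> 'Hom(space i, space j)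
}.

Lemma neqC (i j : I) : i != j -> j != i.
Proof. by rewrite eq_sym. Qed.

Section Representation.
Variables (Gamma : I -> I -> nat) (q : K) (c : nat -> nat -> K).
Variable Psi : quiver_rep.
Local Notation A := (arrow Psi).

Definition fixed_part (i j : I) (ij : i != j) : {vspace Psi i} :=
  lker ((A (neqC ij) \o A ij) - \1)%VF.

Definition H_representation : Prop :=
  [/\ forall (i j : I) (ij : i != j),
        couple (c (Gamma i j)) (Gamma i j) q (A ij) (A (neqC ij)),
      forall (i j k : I) (ij : i != j) (jk : j != k) (ik : i != k) (x : Psi i),
        x \in fixed_part ij -> A ik x = A jk (A ij x)
    & forall (i j k : I) (ij : i != j) (kj : k != j) (ki : k != i),
        (limg (A kj - (A ij \o A ki))%VF
         <= limg (\1 - (A ij \o A (neqC ij)))%VF)%VS].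

End Representation.
End Coxeter.

(* Main.v *)
Require Import Defs.
From mathcomp Require Import all_boot all_order all_algebra.

Set Implicit Arguments.
Unset Strict Implicit.
Unset Printing Implicit Defensive.

Import GRing.Theory.
Local Open Scope ring_scope.

(** If every $V_{i,j}$ vanishes, then 1 is not an eigenvalue of any composite $A^j_iA^i_j$, so
    couples and specialized couples coincide. Axiom (b) then concerns only $x=0$. In (c),
    $id-A^i_jA^j_i$ has kernel $V_{j,i}=0$, hence is onto by finite dimension, and the inclusion is
    trivial. *)

(** Reversing an arrow twice may give another proof of [i != j]; such proofs are unique, so the
    arrow is the same. *)
Lemma fixed_part_neqC (I : finType) (K : fieldType)
    (Psi : quiver_rep I K) (i j : I) (ij : i != j) :
  fixed_part Psi (neqC ij) =
  lker ((arrow Psi ij \o arrow Psi (neqC ij)) - \1)%VF.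
Proof. by rewrite /fixed_part (bool_irrelevance (neqC (neqC ij)) ij). Qed.

(** The two lists of eigenvalues differ only by 1, whose eigenspace is the kernel assumed to
    vanish. *)
Lemma diagonalizable_with_couple_eigenvalue (K : fieldType) (c : nat -> K)
    (m : nat) (q : K) (V : vectType K) (f : 'End(V)) :
  lker (f - \1)%VF = 0%VS ->
  diagonalizable_with (couple_eigenvalue c m q) f <->
  diagonalizable_with (specialized_eigenvalue c m q) f.
Proof.
move=> ker0; split=> -[diag_f eig_f]; split=> // a eig_a; last first.
  by right; apply: eig_f.
case: (eig_f a eig_a) => // a1; move: eig_a.
by rewrite a1 /passmx.leigenvalue /passmx.leigenspace scale1r ker0 eqxx.
Qed.

(** Opposite maps have the same kernel, and an injective endomorphism in finite dimension is
    surjective. *)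
Lemma limg_subr_full (K : fieldType) (V : vectType K) (f : 'End(V)) :
  lker (f - \1)%VF = 0%VS -> limg (\1 - f)%VF = fullv.
Proof.
move=> ker0; apply: lker0_limgf; apply/eqP; rewrite -ker0.
by apply/vspaceP => x; rewrite !memv_ker -[(\1 - f)%VF]opprB opp_lfunE oppr_eq0.
Qed.

Theorem theorem2p1 (I : finType) (Gamma : I -> I -> nat) (K : fieldType) (q : K)
    (c : nat -> nat -> K) (Psi : quiver_rep I K)
    (hGamma : coxeter_matrix Gamma)
    (hc : four_cos2_for Gamma c)
    (hq : generic Gamma q)
    (hfix : forall (i j : I) (ij : i != j), fixed_part Psi ij = 0%VS) :
  H_representation Gamma q c Psi <->
  (forall (i j : I) (ij : i != j),
     specialized_couple (c (Gamma i j)) (Gamma i j) q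
       (arrow Psi ij) (arrow Psi (neqC ij))).
Proof.
(* The composite at $V_j$ is controlled by the hypothesis for the reversed pair, $V_{j,i}=0$. *)
have ker0 (i j : I) (ij : i != j) :
    lker ((arrow Psi ij \o arrow Psi (neqC ij)) - \1)%VF = 0%VS.
  by rewrite -fixed_part_neqC hfix.
have coupleP (i j : I) (ij : i != j) :
    couple (c (Gamma i j)) (Gamma i j) q (arrow Psi ij) (arrow Psi (neqC ij)) <->
    specialized_couple (c (Gamma i j)) (Gamma i j) q
      (arrow Psi ij) (arrow Psi (neqC ij)).
  have gfP := diagonalizable_with_couple_eigenvalue
    (c (Gamma i j)) (Gamma i j) q (hfix _ _ ij).
  have fgP := diagonalizable_with_couple_eigenvalue
    (c (Gamma i j)) (Gamma i j) q (ker0 _ _ ij).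
  by split=> -[/gfP gf /fgP fg even_m].
split=> [[coup _ _] i j ij | spec]; first exact/coupleP.
split=> [i j ij | i j k ij jk ik x | i j k ij kj ki].
- exact/coupleP.
- by rewrite hfix memv0 => /eqP ->; rewrite !linear0.
- by rewrite (limg_subr_full (ker0 _ _ ij)) subvf.
Qed.
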